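(* Let $K\subset\mathbb{R}^n$ be a convex body in Behrend position. Then \[ \operatorname{idq}(K)\ \ge\ \frac{1}{\sqrt{n!}\,n^{n/2}}, \] and, as $n\to\infty$, \[ \frac{1}{\sqrt{n!}\,n^{n/2}}\ \sim\ \left(\frac{2\pi}{n}\right)^{1/4}\frac{\sqrt{n+1}}{n!\,e^{n/2}}. \]
   Context: A convex body in $\mathbb{R}^n$ is a compact convex set with nonempty interior. $\mathrm{D}(K)=\max\{\|x-y\|:x,y\in K\}$ is the Euclidean diameter, $\mathrm{vol}(K)$ the $n$-dimensional volume, and $\operatorname{idq}(K)=\mathrm{vol}(K)/\mathrm{D}(K)^n$ the isodiametric quotient. A convex body $K$ is in Behrend position if $\operatorname{idq}(K)=\max_{A\in \mathrm{GL}_n(\mathbb{R})}\operatorname{idq}(AK)$. The notation $f(n)\sim g(n)$ means $\lim_{n\to\infty} f(n)/g(n)=1$. *)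

(* Defs.v *)
From HB Require Import structures.
From mathcomp Require Import all_boot all_order all_algebra.
From mathcomp Require Import all_classical all_reals all_analysis.

Set Implicit Arguments.
Unset Strict Implicit.
Unset Printing Implicit Defensive.

Import Order.TTheory GRing.Theory Num.Theory.
Import numFieldNormedType.Exports.

Local Open Scope classical_set_scope.
Local Open Scope ring_scope.

(* The product of a measure on T and a measure on n.-tuple T, transported to
   n.+1.-tuple T along (x, t) |-> x :: t. *)
Section cons_measure.
Context d (T : measurableType d) (R : realType) (n : nat).

Definition cons_pair (p : T * n.-tuple T) : n.+1.-tuple T :=
  [tuple of p.1 :: p.2].

Definition uncons_pair (t : n.+1.-tuple T) : T * n.-tuple T :=
  (thead t, [tuple of behead t]).

Lemma measurable_cons_pair : measurable_fun setT cons_pair.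
Proof. exact: measurable_cons. Qed.

Lemma measurable_uncons_pair : measurable_fun setT uncons_pair.
Proof.
apply: measurable_fun_pair; first exact: measurable_tnth.
exact: measurable_behead.
Qed.

Lemma cons_pairK : cancel cons_pair uncons_pair.
Proof. by move=> [x t]; congr pair; apply: val_inj. Qed.

Lemma uncons_pairK : cancel uncons_pair cons_pair.
Proof. by move=> t; rewrite [RHS]tuple_eta; apply: val_inj. Qed.

Variables (m1 : {sigma_finite_measure set T -> \bar R})
          (m2 : {sigma_finite_measure set (n.-tuple T) -> \bar R}).

Definition cons_measure : set (n.+1.-tuple T) -> \bar R :=
  pushforward (m1 \x m2)%E cons_pair.

Let measurable_pre A : measurable A -> measurable (cons_pair @^-1` A).
Proof.
by move=> mA; rewrite -[X in measurable X]setTI; exact: measurable_cons_pair.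
Qed.

Let cons_measure0 : cons_measure set0 = 0%E.
Proof. by rewrite /cons_measure /pushforward preimage_set0 measure0. Qed.

Let cons_measure_ge0 A : (0 <= cons_measure A)%E.
Proof. exact: (measure_ge0 (m1 \x m2)%E). Qed.

Let cons_measure_semi_sigma_additive : semi_sigma_additive cons_measure.
Proof.
move=> F mF tF mUF; rewrite /cons_measure /pushforward preimage_bigcup.
apply: measure_semi_sigma_additive.
- by move=> i; exact: measurable_pre.
- apply/trivIsetP => /= i j _ _ ij; rewrite -preimage_setI.
  by move/trivIsetP : tF => /(_ _ _ _ _ ij) ->//; rewrite preimage_set0.
- by rewrite -preimage_bigcup; exact: measurable_pre.
Qed.

HB.instance Definition _ := isMeasure.Build _ _ _ cons_measure
  cons_measure0 cons_measure_ge0 cons_measure_semi_sigma_additive.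

Let cons_measure_sigma_finite : sigma_finite setT cons_measure.
Proof.
have /sigma_finiteP[F [TF ndF Foo]] := sigma_finiteT m1.
have /sigma_finiteP[G [TG ndG Goo]] := sigma_finiteT m2.
exists (fun k => uncons_pair @^-1` (F k `*` G k)).
  rewrite -preimage_bigcup -[LHS](preimage_setT uncons_pair) -setXTT TF TG.
  congr (_ @^-1` _); apply/seteqP; split => -[x y] /=.
    move=> [[i _ Fix] [j _ Gjy]]; exists (maxn i j) => //; split.
    - by move: x Fix; exact/subsetPset/ndF/leq_maxl.
    - by move: y Gjy; exact/subsetPset/ndG/leq_maxr.
  by move=> [i _ []/= ? ?]; split; exists i.
move=> k; have [mF Fk] := Foo k; have [mG Gk] := Goo k; split.
  rewrite -[X in measurable X]setTI.
  by apply: measurable_uncons_pair => //; exact: measurableX.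
rewrite /cons_measure /pushforward -comp_preimage.
rewrite (_ : _ \o _ = id) ?preimage_id; last exact/funext/cons_pairK.
by rewrite product_measure1E// lte_mul_pinfty// ge0_fin_numE.
Qed.

HB.instance Definition _ := Measure_isSigmaFinite.Build _ _ _ cons_measure
  cons_measure_sigma_finite.

End cons_measure.

(* n-dimensional Lebesgue measure on the Borel sets of R^n, as the n-fold
   product of the Lebesgue measure of R. *)
Fixpoint lebesgue_tuple (R : realType) (n : nat) :
    {sigma_finite_measure set (n.-tuple (measurableTypeR R)) -> \bar R} :=
  match n with
  | 0 => \d_([tuple] : 0.-tuple (measurableTypeR R))
  | m.+1 => cons_measure (@lebesgue_measure R) (lebesgue_tuple R m)
  end.

Section isodiametric.
Context {R : realType} {n : nat}.
Implicit Types K : set 'rV[R]_n.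

Definition vol K : \bar R :=
  lebesgue_tuple R n [set t | K (\row_i tnth t i)].

(* The norm `|x| that the library puts on 'rV[R]_n is the maximum norm; it
   induces the same topology, but the diameter needs the Euclidean one. *)
Definition enorm (x : 'rV[R]_n) : R := Num.sqrt (\sum_i x 0 i ^+ 2).

Definition convex_body K : Prop := [/\ compact K, convex_set K & K° !=set0].

(* A maximum whenever K is compact and nonempty. *)
Definition diam K : R :=
  sup [set enorm (p.1 - p.2) | p in K `*` K].

Definition idq K : R := fine (vol K) / diam K ^+ n.

Definition is_maximum (S : set R) (m : R) : Prop := S m /\ ubound S m.

(* Vectors are rows, so the linear image of K under A is {x *m A : x in K}. *)
Definition linear_image (A : 'M[R]_n) K : set 'rV[R]_n :=
  [set x *m A | x in K].

Definition Behrend_position K : Prop :=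
  is_maximum [set idq (linear_image A K) | A in [set A | A \in unitmx]] (idq K).

End isodiametric.

Definition asymp_equiv (R : realType) (f g : nat -> R) : Prop :=
  (fun n => f n / g n) @ \oo --> (1 : R).

(* Main.v *)
(* Let L = K - K, and call A admissible if LA lies in the Euclidean unit ball.
   If det A ^ 2 is close to its supremum over the admissible A, then for every
   orthogonal projection P of rank m some u in LA satisfies
   |Pu|^2 >= (1 - eta) m / n; otherwise stretching the image of P and shrinking
   its complement would yield an admissible matrix of larger determinant.
   Applying this successively to the complements of the vectors already found,
   and rotating by Householder reflections, one obtains v_0, ..., v_{n-1} in L
   such that (v_j A)_j is a lower triangular family with
   (v_j A)_j^2 >= (1 - eta)(n - j)/n.  As KA contains translates of the segments
   [0, v_j A], its volume is at least \prod_j |(v_j A)_j| / n!, and its diameter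
   is at most 1.  Maximality of idq K and eta -> 0 give the inequality.
   The asymptotics is Stirling's formula: with X n = n!^2 e^(2n) / n^(2n+1), the
   inequalities 2(y - 1)/(y + 1) <= ln y <= (y - 1/y)/2 show that X n / X (2n)
   tends to 1, while X n ^ 2 / X (2n) is given by Wallis' product. *)

Require Import Defs.
From mathcomp Require Import all_boot all_order all_algebra.
From mathcomp Require Import all_classical all_reals all_analysis.
From mathcomp Require Import perm measurable_realfun ring lra.

Set Implicit Arguments.
Unset Strict Implicit.
Unset Printing Implicit Defensive.

Import Order.TTheory GRing.Theory Num.Theory.
Import numFieldNormedType.Exports.

Local Open Scope classical_set_scope.
Local Open Scope ring_scope.

(** * Borel sets of rows, pulled back to tuples *)

Definition row_of_tuple (T : Type) (n : nat) (t : n.-tuple T) : 'rV[T]_n :=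
  \row_i tnth t i.

Section measurability.
Context {R : realType} {n : nat}.
Implicit Type K : set 'rV[R]_n.

Local Notation rowT := (@row_of_tuple (measurableTypeR R) n).

Lemma measurable_row_box (a b : 'I_n -> R) :
  measurable (rowT @^-1` [set v | forall i, a i < v 0 i < b i]).
Proof.
rewrite (_ : _ @^-1` _ = \bigcap_(i in [set: 'I_n])
    (fun t : n.-tuple (measurableTypeR R) => tnth t i) @^-1` `]a i, b i[%classic).
  apply: fin_bigcap_measurable => [|i _]; first exact: finite_finset.
  rewrite -[X in measurable X]setTI.
  by apply: measurable_tnth => //; exact: measurable_itv.
apply/seteqP; split=> t /= H.
  by move=> i _ /=; rewrite in_itv /=; have := H i; rewrite mxE.
by move=> i; have := H i I; rewrite /= in_itv /= mxE.
Qed.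

(** The topology lives on rows and the sigma-algebra on tuples, where coordinates are measurable.
    They meet through the countably many boxes with rational centre and half-width [1/(k+1)], which
    exhaust any open set. *)
Lemma open_measurable_row (U : set 'rV[R]_n) :
  open U -> measurable (rowT @^-1` U).
Proof.
move=> oU.
pose box (p : 'rV[rat]_n * nat) : set 'rV[R]_n :=
  [set v | forall i, ratr (p.1 0 i) - p.2.+1%:R^-1 < v 0 i
                     < ratr (p.1 0 i) + p.2.+1%:R^-1].
pose good := [set p | box p `<=` U].
rewrite (_ : _ @^-1` U = \bigcup_(p in good) rowT @^-1` box p).
  rewrite bigcup_mkcond.
  apply: countable_bigcupT_measurable => [|p].
    exact: countableP.
  by case: ifP => // _; exact: measurable_row_box.
rewrite -preimage_bigcup; congr (_ @^-1` _).
apply/seteqP; split=> [v Uv|v [p gp]]; last exact: gp.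
have /nbhs_ballP[e /= e0 eU] : nbhs v U by exact: open_nbhs_nbhs.
(* Chosen so that [2/(k+1) < e]: the points of the box are within [1/(k+1)] of its centre, which is
   itself within [1/(k+1)] of [v]. *)
pose k := Num.truncn (2 / e).
have k0 : 0 < k.+1%:R^-1 :> R by rewrite invr_gt0 ltr0n.
have ke : 2 * k.+1%:R^-1 < e.
  rewrite ltr_pdivrMr ?ltr0n// mulrC -ltr_pdivrMr//.
  by have := truncnS_gt (2 / e).
have [d dE] : exists d : R, d = k.+1%:R^-1 by exists k.+1%:R^-1.
rewrite -dE in k0 ke.
have /choice[q qP] : forall i, exists q : rat,
    ratr q \in `](v 0 i - d), (v 0 i + d)[.
  by move=> i; apply: rat_in_itvoo; lra.
exists (\row_i q i, k); last first.
  move=> i /=; have := qP i; rewrite !mxE -dE in_itv /= => /andP[? ?].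
  by apply/andP; split; lra.
move=> w /= ww; apply: eU; split => // i j; rewrite (ord1 i).
have := qP j; rewrite in_itv /= => /andP[? ?].
have := ww j; rewrite !mxE -dE => /andP[? ?].
by rewrite /ball /= ltr_norml; apply/andP; split; lra.
Qed.

Lemma compact_measurable_row K : compact K -> measurable (rowT @^-1` K).
Proof.
move=> cK; rewrite -(setCK K) -preimage_setC.
apply: measurableC; apply: open_measurable_row; apply: closed_openC.
exact: (compact_closed (@norm_hausdorff _ _)).
Qed.

End measurability.

(** * Rows by coordinates, and splitting off the first one *)

Lemma continuous_rV (T : topologicalType) (R : realType) (n : nat)
    (f : T -> 'rV[R]_n) :
  (forall i, continuous (fun x => f x 0 i)) -> continuous f.
Proof.
move=> cf x A [P nP sPA].
suff : \forall y \near x, forall j, P 0 j (f y 0 j).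
  by apply: filterS => y Py; apply: sPA => i j; rewrite (ord1 i).
apply: filter_forall => j; apply: cf; exact: nP.
Qed.

Definition vcons (R : Type) (n : nat) (x : R) (v : 'rV[R]_n) : 'rV[R]_n.+1 :=
  \row_i oapp (v 0) x (unlift ord0 i).

Definition vtail (R : Type) (n : nat) (v : 'rV[R]_n.+1) : 'rV[R]_n :=
  \row_i v 0 (lift ord0 i).

Section vcons.
Context {R : realType} {n : nat}.
Implicit Types (x : R) (v : 'rV[R]_n).

Lemma vcons_head x v : vcons x v 0 ord0 = x.
Proof. by rewrite mxE unlift_none. Qed.

Lemma vcons_lift x v i : vcons x v 0 (lift ord0 i) = v 0 i.
Proof. by rewrite mxE liftK. Qed.

Lemma vconsK x v : vtail (vcons x v) = v.
Proof. by apply/rowP => i; rewrite mxE vcons_lift. Qed.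

Lemma vcons_row_of_tuple (x : R) (t : n.-tuple R) :
  vcons x (row_of_tuple t) = row_of_tuple [tuple of x :: t].
Proof.
apply/rowP => i; case: (unliftP ord0 i) => [j|] ->.
  by rewrite vcons_lift !mxE tnthS.
by rewrite vcons_head mxE tnth0.
Qed.

End vcons.

(** * Slicing and finiteness of volumes *)

Section vol_fubini.
Context {R : realType} {n : nat}.
Implicit Type K : set 'rV[R]_n.+1.
Local Open Scope ereal_scope.

Let cross K : set (measurableTypeR R * n.-tuple (measurableTypeR R)) :=
  [set p | K (vcons p.1 (row_of_tuple p.2))].

Let vol_cross K : vol K = (@lebesgue_measure R \x lebesgue_tuple R n) (cross K).
Proof.
rewrite /vol /= /cons_measure /pushforward; congr (_ _).
by apply/seteqP; split=> -[x t] /=; rewrite /cross /= vcons_row_of_tuple.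
Qed.

Let measurable_cross K : compact K -> measurable (cross K).
Proof.
move=> cK; have mK := compact_measurable_row cK.
rewrite -[cross K]setTI.
have := measurable_cons_pair measurableT mK.
congr (_ (_ `&` _)).
by apply/seteqP; split=> -[x t] /=; rewrite /cross /= vcons_row_of_tuple.
Qed.

Lemma vol_fubini1 K :
  vol K = \int[lebesgue_measure]_x vol [set v | K (vcons x v)].
Proof.
rewrite vol_cross; apply: eq_integral => x _ /=.
by congr (lebesgue_tuple _ _ _); apply/seteqP; split=> t;
  rewrite /xsection /= ?inE.
Qed.

(** [\x] integrates sections over the first factor and [\x^] over the second; they agree on
    rectangles, hence on measurable sets by uniqueness of the product measure. *)
Lemma vol_fubini2 K : compact K ->
  vol K = \int[lebesgue_tuple R n]_t
    lebesgue_measure [set x | K (vcons x (row_of_tuple t))].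
Proof.
move=> cK; rewrite vol_cross.
rewrite (@product_measure_unique _ _ _ _ _ _ _
    (@lebesgue_measure R \x^ lebesgue_tuple R n)) //; last 2 first.
- by move=> A B mA mB; exact: product_measure2E.
- exact: measurable_cross.
apply: eq_integral => t _ /=.
by congr (lebesgue_measure _); apply/seteqP; split=> x;
  rewrite /ysection /= ?inE.
Qed.

Lemma measurable_vol_section K : compact K ->
  measurable_fun [set: measurableTypeR R]
    (fun x => vol [set v | K (vcons x v)]).
Proof.
move=> /measurable_cross mK.
have := measurable_fun_xsection (lebesgue_tuple R n) mK.
congr (measurable_fun _ _); apply/funext => x /=.
by congr (lebesgue_tuple _ _ _); apply/seteqP; split=> t;
  rewrite /xsection /= ?inE.
Qed.

Lemma measurable_lebesgue_section K : compact K ->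
  measurable_fun [set: n.-tuple (measurableTypeR R)]
    (fun t => lebesgue_measure [set x | K (vcons x (row_of_tuple t))]).
Proof.
move=> /measurable_cross mK.
have := measurable_fun_ysection (@lebesgue_measure R) mK.
congr (measurable_fun _ _); apply/funext => t /=.
by congr (lebesgue_measure _); apply/seteqP; split=> x;
  rewrite /ysection /= ?inE.
Qed.

Lemma measurable_section K (t : n.-tuple R) : compact K ->
  measurable ([set x | K (vcons x (row_of_tuple t))] : set (measurableTypeR R)).
Proof.
move=> /measurable_cross mK.
have := measurable_ysection (t : n.-tuple (measurableTypeR R)) mK.
by congr (measurable _); apply/seteqP; split=> x; rewrite /ysection /= ?inE.
Qed.

End vol_fubini.

(** Finiteness matters because [fine] sends [+oo] to 0, so that a lower bound on [vol] alone would
    say nothing about [idq]. It comes from enclosing [K] in an open cube. *)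
Lemma vol_lty (R : realType) (n : nat) (K : set 'rV[R]_n) :
  compact K -> (vol K < +oo)%E.
Proof.
pose box m (M : R) := [set v : 'rV[R]_m | forall i, - M < v 0 i < M].
have mbox m M : measurable (@row_of_tuple (measurableTypeR R) m @^-1` box m M).
  exact: (measurable_row_box (fun=> - M) (fun=> M)).
have vol_box m M : 0 < M -> (vol (box m M) < +oo)%E.
  move=> M0; elim: m => [|m IH].
    by rewrite /vol /= diracE ltry.
  rewrite /vol /= /cons_measure /pushforward.
  rewrite (_ : _ @^-1` _ = `]-M, M[%classic `*`
      (@row_of_tuple (measurableTypeR R) m @^-1` box m M)); last first.
    apply/seteqP; split=> -[x t] /=.
      move=> H; split; first by have := H ord0; rewrite mxE /= in_itv.
      by move=> i; have := H (lift ord0 i); rewrite !mxE /= tnthS.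
    move=> [xM tM] i; case: (unliftP ord0 i) => [j|] ->.
      by have := tM j; rewrite !mxE /= tnthS.
    by move: xM; rewrite mxE /= in_itv.
  rewrite product_measure1E//; last exact: mbox.
  suff: (lebesgue_measure (`](- M)%R, M[%classic : set R) *
         vol (box m M) < +oo)%E by [].
  rewrite lebesgue_measure_itv /= lte_fin ifT; last by lra.
  by rewrite lte_mul_pinfty//= lee_fin; lra.
move=> cK; have [M [_ KM]] := compact_bounded cK.
(* On [K] the max norm is at most [|M| + 1]; one more unit makes the inequalities of the open cube
   strict. *)
pose M1 := `|M| + 2.
have M10 : 0 < M1 by rewrite ltr_wpDl.
apply: le_lt_trans (vol_box n M1 M10); rewrite le_measure ?inE//.
- exact: compact_measurable_row.
- exact: mbox.
- move=> t /= Kt i.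
  have : `|\row_i tnth t i| <= `|M| + 1.
    by apply: KM => //; rewrite (le_lt_trans (ler_norm _))// ltrDl.
  move=> /(le_trans _) tM; rewrite -ltr_norml.
  apply: (@le_lt_trans _ _ (`|M| + 1)); last by rewrite ltrD2l ltr1n.
  apply: tM.
  rewrite [leRHS]mx_normrE.
  exact: (le_bigmax _ (fun ij : 'I_1 * 'I_n => `|_ ij.1 ij.2|) (0, i)).
Qed.

(** * Volume of a convex set containing a triangular family of segments *)

Lemma integral_exprn01 (R : realType) (n : nat) :
  (\int[lebesgue_measure]_(x in `[0%R, 1%R]) (x ^+ n)%:E
   = (n.+1%:R^-1 : R)%:E)%E.
Proof.
pose F := horner (n.+1%:R^-1 *: 'X^(n.+1) : {poly R}).
have dF (x : R) : is_derive x 1 F (x ^+ n).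
  apply: is_derive_eq; rewrite derivZ derivXn hornerZ hornerMn hornerXn /=.
  by rewrite -[x ^+ n *+ _]mulr_natl mulKf ?pnatr_eq0.
have cF : continuous F by move=> x; exact: continuous_horner.
rewrite (@continuous_FTC2 _ _ F)//.
- by rewrite /F !hornerZ !hornerXn expr1n expr0n /= mulr0 mulr1 sube0.
- by apply: continuous_subspaceT => x; exact: exprn_continuous.
- split; first by move=> x _; exact: ex_derive.
  + exact: cvg_at_right_filter (cF 0).
  + exact: cvg_at_left_filter (cF 1).
- by move=> x _; rewrite derive1E; exact: derive_val.
Qed.

Lemma le_lebesgue_segment (R : realType) (E : set (measurableTypeR R))
    (m l : R) : measurable E ->
  (forall t, 0 <= t <= 1 -> E (m + t * l)) ->
  (`|l|%:E <= lebesgue_measure E)%E.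
Proof.
move=> mE sE.
have key a b : a < b -> (forall x, a <= x <= b -> E x) ->
    ((b - a)%:E <= lebesgue_measure E)%E.
  move=> ab abE; have := @lebesgue_measure_itv R `[a, b].
  rewrite /= lte_fin ab -EFinB => <-.
  rewrite le_measure ?inE// => x /=; rewrite in_itv /=; exact: abE.
have [l0|l0|->] := ltgtP l 0; last by rewrite normr0 measure_ge0.
- rewrite (ltr0_norm l0) (_ : - l = m - (m + l)); last by lra.
  apply: key => [|x xI]; first by lra.
  have -> : x = m + (m - x) / (- l) * l.
    by rewrite invrN mulrN mulNr divfK ?lt_eqF//; lra.
  apply: sE; rewrite divr_ge0 ?ler_pdivrMr; lra.
- rewrite (gtr0_norm l0) [X in X%:E](_ : l = m + l - m); last by lra.
  apply: key => [|x xI]; first by lra.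
  have -> : x = m + (x - m) / l * l by rewrite divfK ?gt_eqF//; lra.
  apply: sE; rewrite divr_ge0 ?ler_pdivrMr; lra.
Qed.

(** Convexity with a plain real parameter, in place of the interval-typed one of [convex_set]. *)
Definition segment_closed (R : realType) (V : lmodType R) (C : set V) : Prop :=
  forall u v t, C u -> C v -> 0 <= t <= 1 -> C ((1 - t) *: u + t *: v).

Lemma compact_affine_tail (R : realType) (n : nat) (C : set 'rV[R]_n.+1)
    (p : 'rV[R]_n) (r : R) : compact C ->
  compact [set (1 - r) *: p + r *: vtail c | c in C].
Proof.
move=> cC; apply: continuous_compact => //; apply: continuous_subspaceT.
apply: continuous_rV => i c; under eq_fun do rewrite !mxE.
apply: (@cvgD _ _ _ (nbhs c)); first exact: cvg_cst.
apply: (@cvgM _ _ (nbhs c)); first exact: cvg_cst.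
exact: coord_continuous.
Qed.

(* The first coordinate of the points of this set plays the role of the
   homothety ratio: its section at r is the image of the projection of C under
   the homothety of ratio r centred at p. *)
Definition tail_cone (R : realType) (n : nat) (C : set 'rV[R]_n.+1)
    (p : 'rV[R]_n) : set 'rV[R]_n.+1 :=
  [set vcons z.1 ((1 - z.1) *: p + z.1 *: vtail z.2) | z in `[0, 1] `*` C].

Lemma compact_tail_cone (R : realType) (n : nat) (C : set 'rV[R]_n.+1)
    (p : 'rV[R]_n) : compact C -> compact (tail_cone C p).
Proof.
move=> cC; apply: (@continuous_compact (R * 'rV[R]_n.+1)%type); last first.
  by apply: compact_setX => //; exact: segment_compact.
apply: continuous_subspaceT; apply: continuous_rV => i.
have cfst : continuous (fst : R * 'rV[R]_n.+1 -> R) by move=> z; exact: cvg_fst.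
have csnd : continuous (snd : R * 'rV[R]_n.+1 -> _) by move=> z; exact: cvg_snd.
case: (unliftP ord0 i) => [j|] ->; last first.
  by under eq_fun do rewrite vcons_head.
under eq_fun do rewrite vcons_lift !mxE.
move=> z; apply: (@cvgD _ _ _ (nbhs z)).
  apply: (@cvgM _ _ (nbhs z)); last exact: cvg_cst.
  by apply: (@cvgB _ _ _ (nbhs z)); [exact: cvg_cst|exact: cfst].
apply: (@cvgM _ _ (nbhs z)); first exact: cfst.
apply: (@continuous_comp _ _ _ snd (fun c : 'rV[R]_n.+1 => c 0 (lift ord0 j))).
  exact: csnd.
exact: coord_continuous.
Qed.

Lemma tail_cone_section (R : realType) (n : nat) (C : set 'rV[R]_n.+1)
    (p : 'rV[R]_n) (r : R) : 0 <= r <= 1 ->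
  [set v | tail_cone C p (vcons r v)] =
  [set (1 - r) *: p + r *: vtail c | c in C].
Proof.
move=> r01; apply/seteqP; split=> [v [[s c] [/= _ Cc]] /= e|v [c Cc <-]].
  have := congr1 (fun u : 'rV_n.+1 => u 0 ord0) e; rewrite !vcons_head => <-.
  by exists c => //; rewrite -[RHS](vconsK r) -e vconsK.
by exists (r, c) => //; split => //=; rewrite in_itv.
Qed.

(** If [v = (1 - r) vtail x + r vtail c], convexity puts the points [(1 - r)(x + t w) + r c] in [C].
    As [w] has zero tail, they all have tail [v] and only their first coordinate moves with [t]. *)
Lemma tail_cone_fiber (R : realType) (n : nat) (C : set 'rV[R]_n.+1)
    (x w : 'rV[R]_n.+1) (v : 'rV[R]_n) (r : R) :
  segment_closed C -> C x -> C (x + w) -> vtail w = 0 ->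
  tail_cone C (vtail x) (vcons r v) -> 0 <= r <= 1 /\
  exists m, forall t, 0 <= t <= 1 -> C (vcons (m + t * ((1 - r) * w 0 ord0)) v).
Proof.
move=> sC Cx Cxw w0 [[s c] [/= s01 Cc] e].
have sr : s = r.
  by have := congr1 (fun u : 'rV_n.+1 => u 0 ord0) e; rewrite !vcons_head.
rewrite sr {s sr} in s01 e; rewrite in_itv /= in s01.
split=> //; exists ((1 - r) * x 0 ord0 + r * c 0 ord0) => s s01'.
have := sC _ _ _ (sC _ _ _ Cx Cxw s01') Cc s01.
congr C; apply/rowP => i; case: (unliftP ord0 i) => [j|] ->.
  rewrite vcons_lift -[v in RHS](vconsK r) -e vconsK.
  have : w 0 (lift ord0 j) = 0.
    by have := congr1 (fun u : 'rV_n => u 0 j) w0; rewrite !mxE.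
  by rewrite !mxE => ->; ring.
rewrite vcons_head !mxE; ring.
Qed.

(* By convexity, over a point of homothety ratio r the fibre of C has length at
   least (1 - r)`|a|, which bounds `|a| times the length of the cone's fibre. *)
Lemma vol_ge_tail_cone (R : realType) (n : nat) (C : set 'rV[R]_n.+1)
    (x w : 'rV[R]_n.+1) :
  compact C -> segment_closed C -> C x -> C (x + w) -> vtail w = 0 ->
  (`|w 0 ord0|%:E * vol (tail_cone C (vtail x)) <= vol C)%E.
Proof.
move=> cC sC Cx Cxw w0; set a := w 0 ord0; set S := tail_cone _ _.
have cS : compact S by exact: compact_tail_cone.
have [a0|a0] := eqVneq a 0; first by rewrite a0 normr0 mul0e measure_ge0.
have {}a0 : 0 < `|a| by rewrite normr_gt0.
rewrite (vol_fubini2 cC) (vol_fubini2 cS) -ge0_integralZl//; last first.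
  exact: measurable_lebesgue_section.
apply: ge0_le_integral => //.
- by move=> t _; rewrite mule_ge0.
- by apply: measurable_funeM; exact: measurable_lebesgue_section.
- exact: measurable_lebesgue_section.
move=> t _; set v := row_of_tuple t; set Ct := [set _ | C _].
have mCt : measurable (Ct : set (measurableTypeR R)) by exact: measurable_section.
have mSt : measurable ([set r | S (vcons r v)] : set (measurableTypeR R)).
  exact: measurable_section.
have Ctr r : S (vcons r v) ->
    0 <= r <= 1 /\ ((`|a| * (1 - r))%:E <= lebesgue_measure Ct)%E.
  move=> /(tail_cone_fiber sC Cx Cxw w0)[r01 [m mP]]; split=> //.
  have r0 : 0 <= 1 - r by rewrite subr_ge0; case/andP: r01.
  have -> : `|a| * (1 - r) = `|(1 - r) * a| by rewrite normrM (ger0_norm r0) mulrC.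
  exact: le_lebesgue_segment mP.
have CtV : (0 <= lebesgue_measure Ct)%E by exact: measure_ge0.
case: (lebesgue_measure Ct) CtV Ctr => [V||] V0 Ctr; [|by rewrite leey|by []].
rewrite lee_fin in V0.
(* By [Ctr] the fibre of the cone lies in [[1 - V/|a|, 1]], where [V] is the length of [Ct]; hence
   the factor [V/|a|]. *)
apply: (@le_trans _ _ (`|a|%:E * (V / `|a|)%:E)%E); last first.
  by rewrite -EFinM mulrC divfK// gt_eqF.
rewrite lee_pmul2l//.
apply: (@le_trans _ _ (lebesgue_measure (`[1 - V / `|a|, 1]%classic : set R))).
  rewrite le_measure ?inE// => r /= /Ctr[r01]; rewrite lee_fin in_itv /= => h.
  suff: 1 - r <= V / `|a| by lra.
  by rewrite ler_pdivlMr// mulrC.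
have Va : 0 <= V / `|a| by rewrite divr_ge0.
rewrite lebesgue_measure_itv /= lte_fin; case: ifPn => _; last by rewrite lee_fin.
by rewrite -EFinB lee_fin; lra.
Qed.

Lemma segment_closed_affine_tail (R : realType) (n : nat)
    (C : set 'rV[R]_n.+1) (p : 'rV[R]_n) (r : R) : segment_closed C ->
  segment_closed [set (1 - r) *: p + r *: vtail c | c in C].
Proof.
move=> sC _ _ t [c Cc <-] [d Cd <-] t01.
exists ((1 - t) *: c + t *: d); first exact: sC.
by apply/rowP => i; rewrite !mxE; ring.
Qed.

(** Induction on the dimension. As [w ord0] has zero tail, the volume of [C] is at least
    [|w ord0 0 ord0|] times that of its tail cone. The section of the cone at [r] contains
    translates of the remaining segments' tails scaled by [r], so its volume is at least [c r^n];
    integrating over [[0, 1]] turns [c] into [c/(n+1)]. *)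
Lemma vol_triangular (R : realType) (n : nat) (C : set 'rV[R]_n)
    (x w : 'I_n -> 'rV[R]_n) :
  compact C -> segment_closed C -> C !=set0 ->
  (forall j, C (x j)) -> (forall j, C (x j + w j)) ->
  (forall j i : 'I_n, (j < i)%N -> w j 0 i = 0) ->
  (((\prod_j `|w j 0 j|) / n`!%:R)%:E <= vol C)%E.
Proof.
elim: n C x w => [|n IH] C x w cC sC C0 Cx Cxw w_tri.
  (* In dimension 0 the measure is a Dirac mass, and a nonempty set has volume 1. *)
  rewrite big_ord0 divr1 /vol /= diracE mem_set//=.
  by case: C0 => c Cc; rewrite (_ : \row_i _ = c)//; apply/rowP => -[].
set c := (\prod_(j < n) `|w (lift ord0 j) 0 (lift ord0 j)|) / n`!%:R.
have c0 : 0 <= c by rewrite divr_ge0// prodr_ge0.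
have -> : (\prod_j `|w j 0 j|) / n.+1`!%:R = `|w ord0 0 ord0| * (c * n.+1%:R^-1).
  by rewrite big_ord_recl factS natrM invfM /c; ring.
have w0 : vtail (w ord0) = 0 by apply/rowP => i; rewrite !mxE w_tri.
have [->|a0] := eqVneq (w ord0 0 ord0) 0.
  by rewrite normr0 mul0r measure_ge0.
apply: le_trans (vol_ge_tail_cone cC sC (Cx ord0) (Cxw ord0) w0).
rewrite EFinM lee_pmul2l//= ?lte_fin ?normr_gt0//.
set p := vtail _.
rewrite vol_fubini1 EFinM -integral_exprn01 -ge0_integralZl//; last 2 first.
- apply/measurable_EFinP; apply: measurable_funTS; exact: measurable_funX.
- by move=> r; rewrite /= in_itv /= lee_fin => /andP[r0 _]; rewrite exprn_ge0.
apply: (@le_trans _ _ (\int[lebesgue_measure]_(r in `[0%R, 1%R])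
    vol [set v | tail_cone C p (vcons r v)])%E); last first.
  apply: ge0_subset_integral => //.
  - by apply: measurable_vol_section; exact: compact_tail_cone.
  apply: ge0_le_integral => //.
- move=> r; rewrite /= in_itv /= => /andP[r0 _].
  by rewrite -EFinM lee_fin mulr_ge0// exprn_ge0.
- apply: measurable_funeM.
  apply/measurable_EFinP; apply: measurable_funTS; exact: measurable_funX.
- apply: measurable_funTS; apply: measurable_vol_section.
  exact: compact_tail_cone.
move=> r; rewrite /= in_itv /= => r01.
rewrite tail_cone_section// -EFinM.
pose aff (c : 'rV[R]_n.+1) := (1 - r) *: p + r *: vtail c.
have -> : c * r ^+ n =
    (\prod_j `|(r *: vtail (w (lift ord0 j))) 0 j|) / n`!%:R.
  have [r0 _] := andP r01.
  under eq_bigr do rewrite !mxE normrM (ger0_norm r0).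
  by rewrite big_split /= prodr_const card_ord /c; ring.
apply: (IH _ (fun j => aff (x (lift ord0 j)))).
- exact: compact_affine_tail.
- exact: segment_closed_affine_tail.
- by case: C0 => d Cd; exists (aff d); exists d.
- by move=> j; exists (x (lift ord0 j)).
- move=> j; exists (x (lift ord0 j) + w (lift ord0 j)) => //.
  by apply/rowP => i; rewrite !mxE; ring.
- by move=> j i ji; rewrite !mxE w_tri ?mulr0.
Qed.

(** * Squared Euclidean norm and reflections *)

Section sqnorm.
Context {R : realType} {n : nat}.
Implicit Types u v : 'rV[R]_n.

Definition sqnorm u : R := \sum_i u 0 i ^+ 2.

Lemma sqnorm_ge0 u : 0 <= sqnorm u.
Proof. by apply: sumr_ge0 => i _; exact: sqr_ge0. Qed.

Lemma enormE u : enorm u = Num.sqrt (sqnorm u).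
Proof. by []. Qed.

Lemma mulmx_tr_sqnorm u : u *m u^T = (sqnorm u)%:M.
Proof.
rewrite [LHS]mx11_scalar; congr _%:M; rewrite mxE.
by apply: eq_bigr => i _; rewrite mxE expr2.
Qed.

Lemma sqnorm_orthogonal (H : 'M[R]_n) u : H *m H^T = 1%:M ->
  sqnorm (u *m H) = sqnorm u.
Proof.
move=> HH; suff : (sqnorm (u *m H))%:M = (sqnorm u)%:M :> 'M[R]_1.
  by move=> /matrixP/(_ 0 0); rewrite !mxE.
by rewrite -!mulmx_tr_sqnorm trmx_mul mulmxA -(mulmxA u) HH mulmx1.
Qed.

Lemma sqnormZ (a : R) u : sqnorm (a *: u) = a ^+ 2 * sqnorm u.
Proof. by rewrite mulr_sumr; apply: eq_bigr => i _; rewrite mxE exprMn. Qed.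

Lemma sqnorm_eq0 u : (sqnorm u == 0) = (u == 0).
Proof.
apply/eqP/eqP => [/eqP|->]; last by apply: big1 => i _; rewrite mxE expr0n.
rewrite psumr_eq0 => [/allP u0|i _]; last exact: sqr_ge0.
apply/rowP => i; rewrite mxE; apply/eqP; rewrite -sqrf_eq0.
by apply: u0; rewrite mem_index_enum.
Qed.

Lemma sqr_le_sqnorm u i : u 0 i ^+ 2 <= sqnorm u.
Proof.
by rewrite /sqnorm (bigD1 i)//= lerDl sumr_ge0// => j _; exact: sqr_ge0.
Qed.

(* A Householder reflection in the coordinates k, ..., n - 1. *)
Lemma exists_reflection (k : 'I_n) u : exists H : 'M[R]_n,
  [/\ H *m H^T = 1%:M,
      forall v, (forall i : 'I_n, (k <= i)%N -> v 0 i = 0) -> v *m H = v,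
      forall i : 'I_n, (k < i)%N -> (u *m H) 0 i = 0 &
      (u *m H) 0 k ^+ 2 = \sum_(i < n | (k <= i)%N) u 0 i ^+ 2].
Proof.
pose w : 'rV[R]_n := \row_i if (k <= i)%N then u 0 i else 0.
set s := \sum_(i | _) _.
have sE : s = sqnorm w.
  rewrite /s big_mkcond; apply: eq_bigr => i _; rewrite mxE.
  by case: ifP => // _; rewrite expr0n.
have s0 : 0 <= s by rewrite sE sqnorm_ge0.
pose rho := Num.sqrt s.
pose e : 'rV[R]_n := delta_mx 0 k.
have eE i : e 0 i = (i == k)%:R by rewrite mxE.
(* [w] and [rho e] have the same norm, so the reflection in the hyperplane orthogonal to [z]
   exchanges them. As [z] vanishes before coordinate [k], vectors supported there are fixed. *)
pose z : 'rV[R]_n := w - rho *: e.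
have zE i : z 0 i = w 0 i - rho * (i == k)%:R by rewrite !mxE.
have zlt v : (forall i : 'I_n, (k <= i)%N -> v 0 i = 0) -> v *m z^T = 0.
  move=> v0; rewrite [LHS]mx11_scalar mxE big1 ?raddf0// => i _.
  rewrite mxE; have [ki|ik] := leqP k i; first by rewrite v0 ?mul0r.
  by rewrite zE mxE leqNgt ik -val_eqE ltn_eqF// mulr0 subr0 mulr0.
have uHE : u = (u - w) + w by rewrite subrK.
have uw (i : 'I_n) : (k <= i)%N -> (u - w) 0 i = 0 by move=> ki; rewrite !mxE ki subrr.
have wz : w *m z^T = (s - rho * w 0 k)%:M.
  rewrite [LHS]mx11_scalar; congr _%:M; rewrite mxE sE /sqnorm.
  under eq_bigr do rewrite [z^T _ _]mxE zE mulrBr -expr2.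
  rewrite sumrB; congr (_ - _); rewrite (bigD1 k)//= eqxx mulr1 mulrC big1 ?addr0//.
  by move=> i /negPf ->; rewrite !mulr0.
have uz : u *m z^T = (s - rho * w 0 k)%:M.
  by rewrite uHE mulmxDl zlt// add0r.
have rho2 : rho ^+ 2 = s by rewrite sqr_sqrtr.
have zz : sqnorm z = 2 * (s - rho * w 0 k).
  rewrite /sqnorm (bigD1 k)//= zE eqxx mulr1.
  rewrite (eq_bigr (fun i => w 0 i ^+ 2)); last first.
    by move=> i /negPf ik; rewrite zE ik mulr0 subr0.
  have : s = w 0 k ^+ 2 + \sum_(i | i != k) w 0 i ^+ 2.
    by rewrite sE /sqnorm (bigD1 k).
  by move: (\sum_(i | i != k) _) => t st; rewrite sqrrB rho2 {1}st; lra.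
(* If [z = 0] then [2 / sqnorm z] is 0 and [H] is the identity, as it should be since then
   [w = rho e]. *)
pose H : 'M[R]_n := 1%:M - (2 / sqnorm z) *: (z^T *m z).
have vH v : v *m H = v - (2 / sqnorm z) *: (v *m z^T *m z).
  by rewrite /H mulmxBr mulmx1 -scalemxAr mulmxA.
have zH : w - z = rho *: e by rewrite /z opprB addrC subrK.
have uH : u *m H = u - z.
  rewrite vH uz mul_scalar_mx scalerA; congr (_ - _).
  have [z0|z0] := eqVneq z 0; first by rewrite z0 scaler0.
  have sz0 : sqnorm z != 0 by rewrite sqnorm_eq0.
  have -> : s - rho * w 0 k = sqnorm z / 2 by rewrite zz; field.
  by rewrite (_ : _ * _ = 1) ?scale1r//; field; rewrite sz0.
have uHi (i : 'I_n) : (k <= i)%N -> (u *m H) 0 i = rho * (i == k)%:R.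
  move=> ki; rewrite uH uHE -addrA zH mxE uw// add0r.
  by rewrite mxE eE.
exists H; split.
- have HT : H^T = H.
    apply/matrixP => i j; rewrite !mxE eq_sym; congr (_ - _ * _).
    by apply: eq_bigr => l _; rewrite !mxE mulrC.
  have zHN : z *m H = - z.
    rewrite vH mulmx_tr_sqnorm mul_scalar_mx scalerA.
    have [->|z0] := eqVneq z 0; first by rewrite scaler0 subr0 oppr0.
    rewrite divfK ?sqnorm_eq0// -[X in X - _]scale1r -scalerBl.
    by rewrite (_ : 1 - 2 = -1) ?scaleN1r//; ring.
  rewrite HT {1}/H mulmxBl mul1mx -scalemxAl -mulmxA zHN mulmxN scalerN opprK.
  by rewrite /H subrK.
- by move=> v v0; rewrite vH zlt// mul0mx scaler0 subr0.
- by move=> i ki; rewrite uHi 1?ltnW// -val_eqE gtn_eqF// mulr0.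
- by rewrite uHi// eqxx mulr1.
Qed.

End sqnorm.

(** * Triangular families in near-optimal linear position *)

Section triangular_position.
Context {R : realType} {n : nat}.
Implicit Types (L : set 'rV[R]_n) (A : 'M[R]_n).

Definition admissible L A : Prop :=
  A \in unitmx /\ forall u, L u -> sqnorm (u *m A) <= 1.

(* A lower bound, uniform in k, for the factor by which [admissible_improve]
   increases the squared determinant. *)
Definition det_gain (eta : R) : R := expR (- eta) / (1 - eta).

(** This is the strict inequality [1 - eta < e^(-eta)]; strictness leaves room for an admissible
    matrix close enough to the supremum. *)
Lemma det_gain_gt1 (eta : R) : 0 < eta < 1 -> 1 < det_gain eta.
Proof.
move=> /andP[e0 e1]; rewrite /det_gain ltr_pdivlMr ?subr_gt0// mul1r.
by apply: expR_gt1Dx; rewrite oppr_eq0 gt_eqF.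
Qed.

(** By [1 + x <= e^x] the first factor is at least [e^(- eta m)], so the product is at least
    [det_gain eta ^ m], and [m >= 1]. For [k = 0] the quotient by [k] is 0 and the first factor is
    1. *)
Lemma det_gain_le (eta : R) (k m : nat) : 0 < eta < 1 -> (0 < m)%N ->
  det_gain eta <=
  (1 + eta * m%:R / k%:R)^-1 ^+ k * (1 - eta)^-1 ^+ m.
Proof.
move=> e01; case: m => // m _; have [e0 e1] := andP e01.
have g1 := det_gain_gt1 e01.
have b0 : 0 <= eta * m.+1%:R / k%:R by rewrite divr_ge0// mulr_ge0// ltW.
apply: (@le_trans _ _ (det_gain eta ^+ m.+1)).
  by rewrite exprS ler_peMr ?exprn_ege1// ltW// (lt_trans ltr01).
have e1' : 0 <= (1 - eta)^-1 by rewrite invr_ge0 subr_ge0 ltW.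
rewrite /det_gain exprMn ler_wpM2r ?exprn_ge0//.
rewrite -expRM_natl mulrN expRN exprVn.
have [->|k0] := eqVneq k 0.
  by rewrite expr0 invr1 invf_le1 ?expR_gt0// -expR0 ler_expR mulr_ge0// ltW.
rewrite lef_pV2 ?posrE ?expR_gt0 ?exprn_gt0 ?ltr_pwDl//.
have -> : m.+1%:R * eta = k%:R * (eta * m.+1%:R / k%:R).
  by field; rewrite pnatr_eq0.
by rewrite expRM_natl lerXn2r ?nnegrE ?expR_ge0 ?addr_ge0// expR_ge1Dx.
Qed.

Lemma prod_ord_threshold (k : 'I_n) (a b : R) :
  \prod_(i < n) (if (k <= i)%N then b else a) = a ^+ k * b ^+ (n - k).
Proof.
rewrite -(big_mkord xpredT (fun i => if (k <= i)%N then b else a)).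
rewrite (@big_cat_nat _ _ _ k)//=; last exact: ltnW.
congr (_ * _).
  rewrite (eq_big_nat _ _ (F2 := fun=> a)) ?prodr_const_nat ?subn0// => i.
  by move=> /andP[_ ik]; rewrite leqNgt ik.
rewrite (eq_big_nat _ _ (F2 := fun=> b)) ?prodr_const_nat// => i.
by move=> /andP[->].
Qed.

(** Squared coordinates from [k] on are multiplied by [a >= 1], the others by [b <= 1]. If [s] and
    [t] are the two parts of the old squared norm, the new one is [a s + b t <= b + (a - b) s],
    which is increasing in [s]; the squared determinant gains the factor [b^k a^m]. *)
Lemma admissible_improve L A (k : 'I_n) (eta : R) : 0 < eta < 1 ->
  admissible L A ->
  (forall u, L u -> \sum_(i < n | (k <= i)%N) (u *m A) 0 i ^+ 2 <=
                    (1 - eta) * (n - k)%:R / n%:R) ->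
  exists2 A', admissible L A' &
    det_gain eta * \det A ^+ 2 <= \det A' ^+ 2.
Proof.
move=> e01 [uA LA] small; have [e0 e1] := andP e01.
pose m := (n - k)%N.
have m0 : (0 < m)%N by rewrite subn_gt0.
have nkm : n%:R = k%:R + m%:R :> R by rewrite -natrD subnKC// ltnW.
(* For [k > 0] this is [k/(k + eta m)], the value that makes the bound on the new squared norm
   exactly 1 when [s = (1 - eta) m/n]. *)
pose b : R := (1 + eta * m%:R / k%:R)^-1.
pose a : R := (1 - eta)^-1.
have b0 : 0 < b.
  by rewrite invr_gt0 ltr_pwDl// divr_ge0// mulr_ge0// ltW.
have a0 : 0 < a by rewrite invr_gt0 subr_gt0.
pose d : 'rV[R]_n := \row_i Num.sqrt (if (k <= i)%N then a else b).
have dE i : d 0 i ^+ 2 = if (k <= i)%N then a else b.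
  by rewrite mxE sqr_sqrtr//; case: ifP => _; exact: ltW.
have detd : \det (diag_mx d) ^+ 2 = b ^+ k * a ^+ m.
  rewrite det_diag -prodrXl (eq_bigr _ (fun i _ => dE i)).
  exact: prod_ord_threshold.
have gain := det_gain_le k e01 m0.
exists (A *m diag_mx d); last first.
  by rewrite det_mulmx exprMn mulrC ler_wpM2l ?sqr_ge0// detd.
split=> [|u Lu].
  rewrite unitmx_mul uA unitmxE unitfE -sqrf_eq0 detd.
  by rewrite mulf_neq0// expf_neq0 ?gt_eqF.
rewrite mulmxA; set v := u *m A.
pose s := \sum_(i < n | (k <= i)%N) v 0 i ^+ 2.
pose t := \sum_(i < n | ~~ (k <= i)%N) v 0 i ^+ 2.
have st : sqnorm v = s + t by rewrite /sqnorm (bigID (fun i : 'I_n => (k <= i)%N)).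
have t0 : 0 <= t by rewrite sumr_ge0// => i _; exact: sqr_ge0.
have -> : sqnorm (v *m diag_mx d) = a * s + b * t.
  rewrite /sqnorm (bigID (fun i : 'I_n => (k <= i)%N))/= !mulr_sumr.
  congr (_ + _); apply: eq_bigr => i ki;
    by rewrite mul_mx_diag mxE exprMn mulrC dE ?ki// (negPf ki).
have st1 : s + t <= 1 by rewrite -st LA.
have sm : s <= (1 - eta) * m%:R / n%:R by exact: small.
(* For [k = 0] division by zero gives [b = 1], but no coordinate is shrunk: [t] is an empty sum. *)
have [k0|k0] := eqVneq (k : nat) 0%N.
  have -> : t = 0.
    by rewrite /t big_pred0// => i; rewrite k0.
  rewrite mulr0 addr0 (le_trans (ler_wpM2l (ltW a0) sm))//.
  rewrite nkm k0 add0r mulfK ?pnatr_eq0 -?lt0n//.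
  by rewrite /a mulVf// gt_eqF// subr_gt0.
have kR : 0 < k%:R :> R by rewrite ltr0n lt0n.
have mR : 0 < m%:R :> R by rewrite ltr0n.
have bE : b * (k%:R + eta * m%:R) = k%:R.
  have q0 : 0 < k%:R + eta * m%:R by rewrite ltr_wpDl ?mulr_gt0// ltW.
  have -> : b = k%:R / (k%:R + eta * m%:R).
    rewrite -invf_div; congr (_^-1); field; exact: lt0r_neq0.
  by rewrite divfK// gt_eqF.
have aE : a * (1 - eta) = 1 by rewrite mulVf// gt_eqF// subr_gt0.
have ba : b <= a.
  rewrite lef_pV2 ?posrE ?subr_gt0 ?ltr_pwDl ?divr_ge0 ?mulr_ge0 ?(ltW e0)//.
  by rewrite (@le_trans _ _ 1) ?lerDl ?divr_ge0 ?mulr_ge0 ?(ltW e0)// gerBl ltW.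
apply: (@le_trans _ _ (b + (a - b) * s)).
  have : b * t <= b * (1 - s) by rewrite ler_pM2l//; lra.
  by lra.
apply: (@le_trans _ _ (b + (a - b) * ((1 - eta) * m%:R / n%:R))).
  by rewrite lerD2l ler_wpM2l// subr_ge0.
rewrite le_eqVlt; apply/orP; left; apply/eqP.
have n0 : n%:R != 0 :> R by rewrite nkm gt_eqF// addr_gt0.
apply: (mulIf n0); rewrite mul1r mulrDl mulrA divfK//.
transitivity (b * (n%:R - (1 - eta) * m%:R) + a * (1 - eta) * m%:R); first by ring.
rewrite aE (_ : _ - _ = k%:R + eta * m%:R); last by rewrite nkm; ring.
by rewrite bE nkm mul1r.
Qed.

(** The rows of [eps A] have norm at most 1, so the entries of [A] are at most [1/eps] in absolute
    value, which bounds every term of the Leibniz formula. *)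
Lemma admissible_det_bounded L (eps : R) : 0 < eps ->
  (forall i, L (eps *: delta_mx 0 i)) ->
  exists M, forall A, admissible L A -> \det A ^+ 2 <= M.
Proof.
move=> eps0 Leps; exists ((\sum_(s : 'S_n) \prod_(i < n) eps^-1) ^+ 2).
move=> A [_ LA]; rewrite -real_normK ?num_real// lerXn2r ?nnegrE//.
  by rewrite sumr_ge0// => s _; rewrite prodr_ge0// => i _; rewrite invr_ge0 ltW.
rewrite (le_trans (ler_norm_sum _ _ _))// ler_sum// => s _.
rewrite normrM normrX normrN1 expr1n mul1r normr_prod ler_prod// => i _.
rewrite normr_ge0/= -[leRHS]mul1r ler_pdivlMr//.
have := LA _ (Leps i); rewrite -scalemxAl sqnormZ -rowE => h.
have {}h : eps ^+ 2 * A i (s i) ^+ 2 <= 1.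
  apply: le_trans h; rewrite ler_wpM2l ?sqr_ge0//.
  by have := sqr_le_sqnorm (row i A) (s i); rewrite mxE.
rewrite -(gtr0_norm eps0) -normrM -(@expr_le1 _ 2)//.
by rewrite real_normK ?num_real// exprMn mulrC.
Qed.

Lemma exists_admissible L (C : R) : (forall u, L u -> sqnorm u <= C) ->
  exists A, admissible L A.
Proof.
(* The summand 1 keeps [c] in [(0, 1]], so that [c^2 |u|^2 <= c |u|^2 <= 1]. *)
move=> LC; pose c := (1 + `|C|)^-1.
have c0 : 0 < c by rewrite invr_gt0 ltr_pwDl.
exists (c%:M); split=> [|u Lu].
  by rewrite unitmxE det_scalar unitfE expf_neq0// gt_eqF.
rewrite mul_mx_scalar sqnormZ expr2 -mulrA.
have cu : c * sqnorm u <= 1.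
  rewrite mulrC ler_pdivrMr ?ltr_pwDl// mul1r (le_trans (LC _ Lu))//.
  by rewrite (le_trans (ler_norm _))// lerDr.
have c1 : c <= 1 by rewrite invf_le1 ?ltr_pwDl// lerDl.
by rewrite mulr_ile1 ?mulr_ge0 ?sqnorm_ge0 // ltW.
Qed.

(** Induction on the number [k] of vectors found. As no admissible matrix can exceed [M],
    [admissible_improve] must fail, which yields [u] with a large part from coordinate [k] on; a
    reflection moves that part into coordinate [k]. The reflection fixes the earlier [v j *m A],
    which vanish from [k] on, and preserves admissibility and the squared determinant. *)
Lemma triangular_admissible L (eta M : R) : 0 < eta < 1 ->
  (forall A, admissible L A -> \det A ^+ 2 <= M) ->
  (exists2 A, admissible L A & M < det_gain eta * \det A ^+ 2) ->
  exists A (v : 'I_n -> 'rV[R]_n), [/\ admissible L A, forall j, L (v j),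
    forall j i : 'I_n, (j < i)%N -> (v j *m A) 0 i = 0 &
    forall j : 'I_n, (1 - eta) * (n - j)%:R / n%:R <= (v j *m A) 0 j ^+ 2].
Proof.
move=> e01 LM exA.
suff /(_ n (leqnn n))[A [v [LA _ H]]] : forall k : nat, (k <= n)%N ->
  exists A (v : 'I_n -> 'rV[R]_n), [/\ admissible L A,
    M < det_gain eta * \det A ^+ 2 &
    forall j : 'I_n, (j < k)%N -> [/\ L (v j),
      forall i : 'I_n, (j < i)%N -> (v j *m A) 0 i = 0 &
      (1 - eta) * (n - j)%:R / n%:R <= (v j *m A) 0 j ^+ 2]].
  by exists A, v; split=> // j; have [] := H j (ltn_ord j).
elim=> [_|k IH kn]; first by have [A LA MA] := exA; exists A, (fun=> 0).
have [A [v [[uA LA] MA vP]]] := IH (ltnW kn).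
pose k' := Ordinal kn.
have [u Lu uP] : exists2 u, L u & (1 - eta) * (n - k')%:R / n%:R <=
    \sum_(i < n | (k' <= i)%N) (u *m A) 0 i ^+ 2.
  apply: contrapT => noU.
  have [|A' LA' ] := @admissible_improve L A k' eta e01 (conj uA LA).
    move=> u Lu; rewrite leNgt; apply/negP => h.
    by apply: noU; exists u => //; exact: ltW.
  by rewrite leNgt (le_lt_trans (LM _ LA') MA).
have [H [HH Hfix Hz Hk]] := exists_reflection k' (u *m A).
(* The entries at indices beyond [k] are placeholders, replaced at later stages. *)
exists (A *m H), (fun j : 'I_n => if (j < k)%N then v j else u); split.
- split=> [|w Lw]; last by rewrite mulmxA sqnorm_orthogonal// LA.
  by rewrite unitmx_mul uA; have [->] := mulmx1_unit HH.
- rewrite det_mulmx exprMn.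
  have -> : \det H ^+ 2 = 1 by rewrite expr2 -[X in _ * X]det_tr -det_mulmx HH det1.
  by rewrite mulr1.
- move=> j; rewrite ltnS leq_eqVlt => /orP[/eqP jk|jk].
    have -> : j = k' :> 'I_n by exact: val_inj.
    rewrite /= ltnn; split=> //; first by move=> i ki; rewrite mulmxA Hz.
    by rewrite mulmxA Hk.
  have [Lvj vj0 vjj] := vP j jk.
  rewrite jk mulmxA Hfix => [//|i ki].
  by rewrite vj0// (leq_trans jk).
Qed.

Lemma triangular_position L (eta eps C : R) : 0 < eta < 1 -> 0 < eps ->
  (forall i, L (eps *: delta_mx 0 i)) -> (forall u, L u -> sqnorm u <= C) ->
  exists A (v : 'I_n -> 'rV[R]_n), [/\ admissible L A, forall j, L (v j),
    forall j i : 'I_n, (j < i)%N -> (v j *m A) 0 i = 0 &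
    forall j : 'I_n, (1 - eta) * (n - j)%:R / n%:R <= (v j *m A) 0 j ^+ 2].
Proof.
move=> e01 eps0 Leps LC.
have [B LB] := admissible_det_bounded eps0 Leps.
have [A0 LA0] := exists_admissible LC.
pose D := [set \det A ^+ 2 | A in admissible L].
have supD : has_sup D.
  by split; [exists (\det A0 ^+ 2), A0|exists B => _ [A LA <-]; exact: LB].
have Dsup A : admissible L A -> \det A ^+ 2 <= sup D.
  by move=> LA; apply: sup_upper_bound => //; exists A.
apply: (triangular_admissible e01 Dsup).
have g1 := det_gain_gt1 e01.
have sup0 : 0 < sup D.
  apply: lt_le_trans (Dsup _ LA0); rewrite exprn_even_gt0//=.
  by have [] := LA0; rewrite unitmxE unitfE.
have g0 : 0 < det_gain eta by exact: lt_trans g1.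
(* The supremum is positive, so [sup D / det_gain eta] lies strictly below it and some admissible
   [A] exceeds that value. *)
have [|_ [A LA <-] h] := sup_adherent _ supD (eps := sup D - sup D / det_gain eta).
  by rewrite subr_gt0 ltr_pdivrMr// ltr_pMr.
exists A => //; move: h; rewrite opprB addrC subrK ltr_pdivrMr//.
by rewrite mulrC.
Qed.

End triangular_position.

(** * Lower bound for the isodiametric quotient *)

Lemma convex_set_segment_closed (R : realType) (n : nat) (K : set 'rV[R]_n) :
  convex_set K -> segment_closed K.
Proof.
move=> cK u v t Ku Kv /andP[t0 t1].
have := cK v u (Itv01 t0 t1) (mem_set Kv) (mem_set Ku).
by rewrite inE [X in _ -> K X]addrC.
Qed.

Lemma prodr_subn_ord (R : pzSemiRingType) (n : nat) :
  \prod_(j < n) (n - j)%:R = n`!%:R :> R.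
Proof.
elim: n => [|n IH]; first by rewrite big_ord0.
by rewrite big_ord_recl subn0 factS natrM -IH.
Qed.

(** Squaring removes the root and the real exponent; both halves of the theorem use the bound in
    this form. *)
Lemma sqr_sqrt_fact_powR (R : realType) (n : nat) :
  (1 / (Num.sqrt n`!%:R * n%:R `^ (n%:R / 2))) ^+ 2 =
  1 / (n`!%:R * n%:R ^+ n) :> R.
Proof.
rewrite expr_div_n expr1n exprMn sqr_sqrtr//; congr (_ / (_ * _)).
by rewrite -powR_mulrn ?powR_ge0// -powRrM divfK ?pnatr_eq0// powR_mulrn.
Qed.

Section Behrend.
Context {R : realType} {n : nat}.
Implicit Type K : set 'rV[R]_n.

(** [compact_bounded] concerns the max norm, which bounds each coordinate and hence the Euclidean
    norm. *)
Lemma compact_sqnorm_bounded K : compact K ->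
  exists C, forall x y, K x -> K y -> sqnorm (x - y) <= C.
Proof.
move=> /compact_bounded[M [_ KM]].
pose B := `|M| + 1.
have KB x i : K x -> `|x 0 i| <= B.
  move=> Kx; apply: (@le_trans _ _ `|x|).
    rewrite [leRHS]mx_normrE.
    exact: (le_bigmax _ (fun ij : 'I_1 * 'I_n => `|_ ij.1 ij.2|) (0, i)).
  by apply: KM => //; rewrite (le_lt_trans (ler_norm _))// ltrDl.
exists (\sum_(i < n) (2 * B) ^+ 2) => x y Kx Ky; apply: ler_sum => i _.
rewrite !mxE -real_normK ?num_real// lerXn2r ?nnegrE//.
  by rewrite mulr_ge0// addr_ge0.
rewrite (le_trans (ler_normB _ _))// mulr2n mulrDl mul1r lerD ?KB//.
Qed.

Lemma interior_differences K : K° !=set0 ->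
  exists2 eps, 0 < eps & forall i : 'I_n,
    exists x y, [/\ K x, K y & eps *: delta_mx 0 i = y - x].
Proof.
move=> [p /nbhs_ballP[e /= e0 eK]]; exists (e / 2) => [|i]; first by rewrite divr_gt0.
exists p, (p + (e / 2) *: delta_mx 0 i); split.
- by apply: eK; exact: ballxx.
- apply: eK; split=> // a b; rewrite !mxE /ball /= opprD addNKr normrN.
  rewrite normrM gtr0_norm ?divr_gt0//.
  rewrite (@le_lt_trans _ _ (e / 2))//; last by lra.
  rewrite ger_pMr ?divr_gt0//.
  by case: (_ && _); rewrite ?normr1 ?normr0.
- by rewrite addrC addKr.
Qed.

Lemma compact_linear_image K (A : 'M[R]_n) : compact K ->
  compact (linear_image A K).
Proof.
move=> cK; apply: continuous_compact => //; apply: continuous_subspaceT.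
apply: continuous_rV => i; under eq_fun do rewrite mxE.
apply: continuous_big => [|j _ x]; first exact: add_continuous.
apply: (@cvgM _ _ (nbhs x)); last exact: cvg_cst.
exact: coord_continuous.
Qed.

(** Stated for the square to avoid roots. The volume contributes [P^2 / n!^2]; the factors [n - j]
    in the bound on [P^2] multiply to [n!], which cancels one of the two factorials. *)
Lemma idq_linear_image_ge K (eta : R) : 0 < eta < 1 -> convex_body K ->
  exists2 A : 'M[R]_n, A \in unitmx &
    0 <= idq (linear_image A K) /\
    (1 - eta) ^+ n / (n`!%:R * n%:R ^+ n) <= idq (linear_image A K) ^+ 2.
Proof.
move=> e01 [cK convK intK]; have [e0 e1] := andP e01.
pose L := [set z | exists x y, [/\ K x, K y & z = y - x]].
have [eps eps0 Leps] := interior_differences intK.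
have [C KC] := compact_sqnorm_bounded cK.
have [|A [v [[uA LA] Lv v0 vv]]] := @triangular_position _ _ L eta eps C e01 eps0 Leps.
  by move=> _ [x [y [Kx Ky ->]]]; exact: KC.
exists A => //.
have /choice[x /choice[y xy]] := Lv.
pose w j := v j *m A; set KA := linear_image A K.
have cKA : compact KA by exact: compact_linear_image.
have KA0 : KA !=set0.
  by have [p Kp] := intK; exists (p *m A), p => //; exact: interior_subset.
have sKA : segment_closed KA.
  move=> _ _ t [a Ka <-] [b Kb <-] t01.
  exists ((1 - t) *: a + t *: b); first exact: convex_set_segment_closed.
  by rewrite mulmxDl -!scalemxAl.
have vwE j : x j *m A + w j = y j *m A.
  by have [_ _ vj] := xy j; rewrite /w vj mulmxBl subrKC.
have volKA : (((\prod_j `|w j 0 j|) / n`!%:R)%:E <= vol KA)%E.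
  apply: (@vol_triangular _ _ KA (fun j => x j *m A) w) => //.
  - by move=> j; exists (x j) => //; have [] := xy j.
  - by move=> j; rewrite vwE; exists (y j) => //; have [] := xy j.
have wA p q : KA p -> KA q -> enorm (p - q) <= 1.
  move=> [a Ka <-] [b Kb <-]; rewrite -mulmxBl enormE -[leRHS]sqrtr1 ler_wsqrtr//.
  by apply: LA; exists b, a.
have [p KAp] := KA0.
pose D := [set enorm (p.1 - p.2) | p in KA `*` KA].
have D0 : D !=set0 by exists (enorm (p - p)), (p, p).
have D1 : ubound D 1 by move=> _ [[a b] [/= Ka Kb] <-]; exact: wA.
have diam1 : diam KA <= 1 by exact: sup_le_ub.
(* For [n = 0] the power is 1; otherwise the first vector [w j] has a nonzero diagonal entry and is
   a difference of points of [KA]. *)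
have diam0 : 0 < diam KA ^+ n.
  have expr_pos (a : R) m : m = 0%N -> 0 < a ^+ m by move=> ->; rewrite expr0.
  have [n0|n0] := posnP n; first exact: expr_pos.
  pose j := Ordinal n0; rewrite exprn_gt0//.
  apply: (@lt_le_trans _ _ (enorm (w j))).
    rewrite enormE sqrtr_gt0 (lt_le_trans _ (sqr_le_sqnorm _ j))//.
    apply: lt_le_trans (vv j); rewrite divr_gt0 ?mulr_gt0 ?subr_gt0 ?ltr0n ?subn_gt0//.
  apply: sup_upper_bound; first by split=> //; exists 1.
  have [Kx Ky _] := xy j.
  exists (y j *m A, x j *m A) => /=; first by split; [exists (y j)|exists (x j)].
  by rewrite -vwE addrC addKr.
have Dn1 : diam KA ^+ n <= 1.
  rewrite exprn_ile1//; apply: (@le_trans _ _ (enorm (p - p))).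
    by rewrite enormE sqrtr_ge0.
  by apply: sup_upper_bound; [split=> //; exists 1|exists (p, p)].
set P := \prod_j _ in volKA.
have P0 : 0 <= P by rewrite prodr_ge0.
have idqP : P / n`!%:R <= idq KA.
  rewrite /idq ler_pdivlMr// (@le_trans _ _ (P / n`!%:R))//.
    by rewrite ler_piMr// divr_ge0.
  have := volKA; have := vol_lty cKA.
  by case: (vol KA) => [r _|//|//]; rewrite lee_fin.
have idq0 : 0 <= P / n`!%:R by rewrite divr_ge0.
split; first exact: le_trans idqP.
apply: (@le_trans _ _ ((P / n`!%:R) ^+ 2)); last first.
  by rewrite lerXn2r ?nnegrE// (le_trans idq0).
have fn0 : n`!%:R != 0 :> R by rewrite pnatr_eq0 -lt0n fact_gt0.
have P2 : (1 - eta) ^+ n * n`!%:R / n%:R ^+ n <= P ^+ 2.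
  rewrite /P -prodrXl -prodr_subn_ord.
  have -> : (1 - eta) ^+ n * (\prod_(j < n) (n - j)%:R) / n%:R ^+ n =
      \prod_(j < n) ((1 - eta) * (n - j)%:R / n%:R).
    by rewrite !big_split /= !prodr_const !card_ord exprVn.
  apply: ler_prod => j _; rewrite real_normK ?num_real// vv andbT.
  by rewrite divr_ge0// mulr_ge0// subr_ge0 ltW.
rewrite expr_div_n ler_pdivlMr ?exprn_gt0 ?ltr0n ?fact_gt0//.
apply: le_trans P2; rewrite le_eqVlt; apply/orP; left; apply/eqP.
have [n0|n0] := eqVneq n 0%N.
  by rewrite n0 !expr0 fact0; field.
by field; rewrite fn0 expf_neq0// pnatr_eq0.
Qed.

Lemma Behrend_idq_ge K : convex_body K -> Behrend_position K ->
  1 / (Num.sqrt n`!%:R * n%:R `^ (n%:R / 2)) <= idq K.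
Proof.
move=> bK [_ Kmax]; set c := 1 / _.
have c0 : 0 <= c by rewrite divr_ge0// mulr_ge0// ?sqrtr_ge0 ?powR_ge0.
have c2 : c ^+ 2 = 1 / (n`!%:R * n%:R ^+ n) by exact: sqr_sqrt_fact_powR.
have key eta : 0 < eta < 1 -> 0 <= idq K /\ (1 - n%:R * eta) * c ^+ 2 <= idq K ^+ 2.
  move=> e01; have [e0 e1] := andP e01.
  have [A uA [A0 Age]] := idq_linear_image_ge e01 bK.
  have AK : idq (linear_image A K) <= idq K by apply: Kmax; exists A.
  have K0 : 0 <= idq K by exact: le_trans AK.
  split=> //; apply: (@le_trans _ _ (idq (linear_image A K) ^+ 2)); last first.
    by rewrite lerXn2r.
  apply: le_trans Age; rewrite c2 div1r ler_wpM2r ?invr_ge0 ?mulr_ge0 ?exprn_ge0//.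
  (* Bernoulli's inequality [1 - n eta <= (1 - eta)^n]. *)
  elim: (n) => [|m IH]; first by rewrite mul0r subr0 expr0.
  rewrite exprS -natr1.
  apply: (@le_trans _ _ ((1 - eta) * (1 - m%:R * eta))).
    have : 0 <= m%:R * eta ^+ 2 by rewrite mulr_ge0 ?sqr_ge0.
    have -> : (1 - eta) * (1 - m%:R * eta) =
      1 - (m%:R + 1) * eta + m%:R * eta ^+ 2 by ring.
    by rewrite lerDl.
  by rewrite ler_wpM2l// subr_ge0 ltW.
have K0 : 0 <= idq K by have [|] := key 2^-1; lra.
rewrite -(@ler_pXn2r _ 2)// ?nnegrE//.
rewrite leNgt; apply/negP => lt2.
(* If the inequality failed by [d > 0], then [t = d/q] would contradict [key]: [d < q] gives
   [t < 1], and [n c^2 < q] gives [n c^2 t < d]. *)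
have [t t0 t1] : exists2 t, 0 < t < 1 & n%:R * c ^+ 2 * t < c ^+ 2 - idq K ^+ 2.
  pose d := c ^+ 2 - idq K ^+ 2; pose q := n%:R * c ^+ 2 + d + 1.
  have d0 : 0 < d by rewrite subr_gt0.
  have nc : 0 <= n%:R * c ^+ 2 by rewrite mulr_ge0 ?sqr_ge0.
  have q0 : 0 < q by rewrite /q; lra.
  exists (d / q).
    by rewrite divr_gt0//= ltr_pdivrMr// mul1r /q; lra.
  rewrite mulrA ltr_pdivrMr// mulrC ltr_pM2l// /q; lra.
have [_] := key t t0; lra.
Qed.

End Behrend.

(** * Wallis' product *)

Section wallis.
Context {R : realType}.
Implicit Types (k n : nat) (x : R).

(* Integration by parts, so that Wallis' integrals need no integration. *)
Fixpoint sin_exp_primitive k x : R :=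
  match k with
  | 0 => x
  | 1 => 1 - cos x
  | (k'.+1 as j).+1 =>
    (j%:R * sin_exp_primitive k' x - cos x * sin x ^+ j) / j.+1%:R
  end.

Lemma is_derive_sin_exp_primitive k x :
  is_derive x 1 (sin_exp_primitive k) (sin x ^+ k).
Proof.
(* The recursion has step two, so two consecutive indices are carried along. *)
suff [] : is_derive x 1 (sin_exp_primitive k) (sin x ^+ k) /\
  is_derive x 1 (sin_exp_primitive k.+1) (sin x ^+ k.+1) by [].
elim: k => [|k [IH IH1]].
  split; first exact: is_derive_id.
  apply: (@is_derive_eq _ _ _ (cst 1 - cos)); by rewrite sub0r opprK.
split=> //.
have -> : sin_exp_primitive k.+2 =
    k.+2%:R^-1 \*: (k.+1%:R \*: sin_exp_primitive k - cos * sin ^+ k.+1).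
  by apply/funext => y; rewrite !fctE /= mulrC.
apply: is_derive_eq.
rewrite /GRing.scale /= !fctE.
have k2 : k.+2%:R != 0 :> R by rewrite pnatr_eq0.
apply: (mulfI k2); rewrite mulVKf//.
have -> : cos x * (k.+1%:R * sin x ^+ k * cos x) =
    k.+1%:R * sin x ^+ k * (1 - sin x ^+ 2) by rewrite -cos2sin2; ring.
by rewrite -[k.+2%:R]natr1 !exprS; ring.
Qed.

Definition wallis_integral k : R := sin_exp_primitive k (pi / 2).

Lemma wallis_integral_rec k :
  wallis_integral k.+2 = k.+1%:R / k.+2%:R * wallis_integral k.
Proof.
by rewrite /wallis_integral /= cos_pihalf mul0r subr0 mulrAC.
Qed.

(** The difference of the primitives vanishes at 0 and has derivative [sin^k (1 - sin) >= 0] on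
    [[0, pi/2]]; the mean value theorem concludes. *)
Lemma wallis_integral_decr k : wallis_integral k.+1 <= wallis_integral k.
Proof.
pose G := sin_exp_primitive k - sin_exp_primitive k.+1.
have dG x : is_derive x 1 G (sin x ^+ k - sin x ^+ k.+1).
  by apply: is_deriveB; exact: is_derive_sin_exp_primitive.
have pi2 : 0 < pi / 2 :> R by rewrite divr_gt0// pi_gt0.
have cG : {within `[0, pi / 2], continuous G}.
  apply: continuous_subspaceT => x.
  by apply/differentiable_continuous/derivable1_diffP; exact: ex_derive.
have [c cI] := MVT pi2 (fun x _ => dG x) cG.
have F0 j : sin_exp_primitive j 0 = 0.
  suff [] : sin_exp_primitive j 0 = 0 /\ sin_exp_primitive j.+1 0 = 0 by [].
  elim: j => [|j [IH IH1]]; first by rewrite /= cos0 subrr.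
  by split=> //=; rewrite IH sin0 expr0n /= !mulr0 subrr mul0r.
rewrite /G !fctE !F0 !subr0 => GE.
rewrite -subr_ge0 /wallis_integral GE.
move: cI; rewrite in_itv /= => /andP[c0 c1].
have sc : 0 <= sin c by apply: sin_ge0_pi; lra.
rewrite mulr_ge0 ?(ltW pi2)// subr_ge0 exprS ler_piMl ?exprn_ge0 ?sin_le1//.
Qed.

(** This is [4^n] over the central binomial coefficient, that is, the product of [2j/(2j - 1)] for
    [1 <= j <= n]. *)
Definition wallis_ratio n : R := 4 ^+ n * n`!%:R ^+ 2 / (n.*2)`!%:R.

Lemma wallis_ratioS n :
  wallis_ratio n.+1 = wallis_ratio n * (2 * n.+1%:R / n.*2.+1%:R).
Proof.
have f2 : (n.*2)`!%:R != 0 :> R by rewrite pnatr_eq0 -lt0n fact_gt0.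
rewrite /wallis_ratio doubleS !factS !natrM exprS.
have -> : n.*2.+2%:R = 2 * n.+1%:R :> R by rewrite -natrM mul2n.
by field; rewrite f2 !nat1r !pnatr_eq0.
Qed.

Lemma wallis_ratio_gt0 n : 0 < wallis_ratio n.
Proof.
by rewrite divr_gt0 ?mulr_gt0 ?exprn_gt0 ?ltr0n ?fact_gt0.
Qed.

Lemma wallis_integral_ratio n :
  wallis_integral n.*2 = pi / (2 * wallis_ratio n) /\
  wallis_integral n.*2.+1 = wallis_ratio n / n.*2.+1%:R.
Proof.
elim: n => [|n [IH IH1]].
  rewrite /wallis_integral /wallis_ratio /= cos_pihalf fact0 expr0 expr1n.
  by rewrite double0; split; field.
have r0 := wallis_ratio_gt0 n.
rewrite doubleS !wallis_integral_rec IH IH1 wallis_ratioS.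
have -> : n.*2.+2%:R = 2 * n.+1%:R :> R by rewrite -natrM mul2n.
by split; field; rewrite ?(gt_eqF r0) ?nat1r -?natrD !pnatr_eq0.
Qed.

(** Write [W] for [wallis_integral]. The upper bound is [W(2n+1) <= W(2n)]; the lower one is
    [W(2n+2) <= W(2n+1)] together with [4n(n+1) <= (2n+1)^2]. *)
Lemma wallis_ratio_bounds n :
  pi * n%:R <= wallis_ratio n ^+ 2 <= pi * (n%:R + 2^-1).
Proof.
have r0 := wallis_ratio_gt0 n.
have [I0 I1] := wallis_integral_ratio n.
have [I2 _] := wallis_integral_ratio n.+1.
have h1 := wallis_integral_decr n.*2.
have h2 := wallis_integral_decr n.*2.+1.
have n2 : n.*2.+1%:R = 2 * n%:R + 1 :> R by rewrite -natr1 -mul2n natrM.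
have n0 : 0 <= n%:R :> R by [].
have pi0 : 0 < pi :> R by exact: pi_gt0.
move: h1 h2; rewrite -doubleS I2 I0 I1 wallis_ratioS n2 -[n.+1%:R]natr1.
set r := wallis_ratio n in r0 *; set a : R := n%:R in n0 *.
have a1 : 0 < 2 * a + 1 by lra.
rewrite ler_pdivrMr// mulrAC ler_pdivlMr ?mulr_gt0// => h1.
have -> : pi / (2 * (r * (2 * (a + 1) / (2 * a + 1)))) =
    pi * (2 * a + 1) / (4 * (a + 1) * r).
  by field; rewrite !gt_eqF//; lra.
have a2 : 0 < 4 * (a + 1) by lra.
rewrite ler_pdivrMr ?(mulr_gt0 a2)// mulrAC ler_pdivlMr// => h2.
apply/andP; split; last by lra.
rewrite -(ler_pM2l a2).
by apply: le_trans (_ : _ <= pi * (2 * a + 1) * (2 * a + 1)) _; lra.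
Qed.

End wallis.

(** * Stirling's formula with explicit error bounds *)

Section stirling.
Context {R : realType}.
Implicit Types (n m : nat) (x y : R).

Lemma nonneg_of_derive_ge1 (f df : R -> R) y : 1 <= y -> f 1 = 0 ->
  (forall x, 1 <= x -> is_derive x 1 f (df x)) ->
  (forall x, 1 <= x -> 0 <= df x) -> 0 <= f y.
Proof.
move=> y1 f1 dfP df0; have [->|yN1] := eqVneq y 1; first by rewrite f1.
have {yN1} y1' : 1 < y by rewrite lt_neqAle eq_sym yN1.
have [c cI E] : exists2 c, c \in `]1, y[%R & f y - f 1 = df c * (y - 1).
  apply: MVT => // [x|].
    by rewrite in_itv /= => /andP[/ltW x1 _]; exact: dfP.
  apply: derivable_within_continuous => x; rewrite in_itv /= => /andP[x1 _].
  by have [] := dfP x x1.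
move: cI; rewrite in_itv /= => /andP[/ltW c1 _].
by move: E; rewrite f1 subr0 => ->; rewrite mulr_ge0 ?df0// subr_ge0.
Qed.

(** The difference of the two sides vanishes at 1 and has derivative [(x - 1)^2 / (x (x + 1)^2)]. *)
Lemma ln_ge_pade y : 1 <= y -> 2 * (y - 1) / (y + 1) <= ln y.
Proof.
move=> y1; rewrite -subr_ge0.
pose f : R -> R := @ln R - (cst 2 - cst 4 * (fun x : R => (x + 1)^-1)).
have -> : ln y - 2 * (y - 1) / (y + 1) = f y.
  by rewrite /f !fctE; field; lra.
apply: (@nonneg_of_derive_ge1 f (fun x => x^-1 - 4 / (x + 1) ^+ 2)) => //.
- by rewrite /f !fctE ln1; field.
- move=> x x1; rewrite /f.
  have x0 : 0 < x by lra.
  have dl := is_derive1_ln x0.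
  have d1 : is_derive x (1 : R) (fun x : R => x + 1) 1.
    by apply: is_derive_eq; rewrite addr0.
  have d2 : is_derive x (1 : R) (fun x : R => (x + 1)^-1) (- (x + 1) ^- 2).
    have x10 : x + 1 != 0 by rewrite gt_eqF//; lra.
    have := @is_deriveV R (fun z : R => z + 1) x 1 1 x10 d1.
    by rewrite /GRing.scale /= mulr1.
  apply: is_derive_eq; rewrite /GRing.scale /=. ring.
- move=> x x1.
  have -> : x^-1 - 4 / (x + 1) ^+ 2 = (x - 1) ^+ 2 / (x * (x + 1) ^+ 2).
    field; lra.
  by rewrite divr_ge0 ?sqr_ge0// mulr_ge0 ?sqr_ge0//; lra.
Qed.

(** The right side is the trapezoid rule for the integral of [1/x] over [[1, y]]; the difference has
    derivative [(1 - 1/x)^2 / 2]. *)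
Lemma ln_le_trapezoid y : 1 <= y -> ln y <= (y - y^-1) / 2.
Proof.
move=> y1; rewrite -subr_ge0.
pose f : R -> R := cst 2^-1 * (id - @GRing.inv R) - @ln R.
have -> : (y - y^-1) / 2 - ln y = f y by rewrite /f !fctE; ring.
apply: (@nonneg_of_derive_ge1 f (fun x => (1 - x^-1) ^+ 2 / 2)) => //.
- by rewrite /f !fctE ln1 invr1 subrr mulr0 subrr.
- move=> x x1; rewrite /f.
  have x0 : 0 < x by lra.
  have dl := is_derive1_ln x0.
  have dV : is_derive x (1 : R) (@GRing.inv R) (- x ^- 2).
    have := @is_deriveV R id x 1 1 (lt0r_neq0 x0) (is_derive_id _ _).
    by rewrite /GRing.scale /= mulr1.
  apply: is_derive_eq; rewrite /GRing.scale /= fctE; field; exact: lt0r_neq0.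
- by move=> x x1; rewrite divr_ge0 ?sqr_ge0.
Qed.

(** The square of [n! / (sqrt n (n/e)^n)], free of roots; its limit is [2 pi]. *)
Definition stirling_ratio n : R :=
  n`!%:R ^+ 2 * expR n.*2%:R / n%:R ^+ n.*2.+1.

(** At index 0 the denominator vanishes and the ratio is 0, hence the shifted indices here and
    below. *)
Lemma stirling_ratio_gt0 n : 0 < stirling_ratio n.+1.
Proof.
apply: divr_gt0; last by rewrite exprn_gt0.
by rewrite mulr_gt0 ?expR_gt0// exprn_gt0// ltr0n fact_gt0.
Qed.

Lemma ln_stirling_ratioB n :
  ln (stirling_ratio n.+1) - ln (stirling_ratio n.+2) =
  n.+1.*2.+1%:R * ln (n.+2%:R / n.+1%:R) - 2.
Proof.
rewrite -ln_div ?posrE ?stirling_ratio_gt0//.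
have -> : stirling_ratio n.+1 / stirling_ratio n.+2 =
    (n.+2%:R / n.+1%:R) ^+ n.+1.*2.+1 * expR (- 2).
  have eS : expR n.+2.*2%:R = expR n.+1.*2%:R * expR 2 :> R.
    by rewrite -expRD -natrD doubleS addn2.
  have pS : n.+2%:R ^+ n.+2.*2.+1 = n.+2%:R ^+ n.+1.*2.+1 * n.+2%:R ^+ 2 :> R.
    by rewrite -exprD addn2.
  rewrite /stirling_ratio eS pS [n.+2`!]factS natrM expr_div_n expRN.
  set a := n.+2%:R ^+ _.+1; set b := n.+1%:R ^+ _.+1; set e := expR n.+1.*2%:R.
  have a0 : a != 0 by rewrite expf_neq0// pnatr_eq0.
  have b0 : b != 0 by rewrite expf_neq0// pnatr_eq0.
  have e0 : e != 0 by rewrite gt_eqF// expR_gt0.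
  have e20 : expR 2 != 0 :> R by rewrite gt_eqF// expR_gt0.
  have f0 : n.+1`!%:R != 0 :> R by rewrite pnatr_eq0 -lt0n fact_gt0.
  by field; rewrite -natrD pnatr_eq0 a0 b0 e0 e20 f0.
rewrite lnM ?posrE ?expR_gt0 ?exprn_gt0 ?divr_gt0// expRK lnXn ?divr_gt0//.
by rewrite -[ln _ *+ _]mulr_natl.
Qed.

(** For [y = (a + 1)/a] the lower bound on [ln y] is [2/(2a + 1)], which cancels the [- 2] exactly.
    The upper one leaves half of [1/a - 1/(a + 1)], a form that telescopes. *)
Lemma ln_stirling_ratioB_bounds n :
  0 <= ln (stirling_ratio n.+1) - ln (stirling_ratio n.+2) <=
  n.+1%:R^-1 - n.+2%:R^-1.
Proof.
rewrite ln_stirling_ratioB; set y := n.+2%:R / n.+1%:R.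
have n0 : 0 < n.+1%:R :> R by [].
have n2 : n.+2%:R = n.+1%:R + 1 :> R by rewrite natr1.
have k2 : n.+1.*2.+1%:R = 2 * n.+1%:R + 1 :> R by rewrite -natr1 -mul2n natrM.
have y1 : 1 <= y by rewrite ler_pdivlMr// mul1r n2 lerDl.
have := ln_ge_pade y1; have := ln_le_trapezoid y1.
rewrite /y k2 n2; set a : R := n.+1%:R in n0 *; clearbody a.
have a0 : a != 0 by exact: lt0r_neq0.
have a1 : a + 1 != 0 by rewrite gt_eqF//; lra.
have k0 : 0 < 2 * a + 1 by lra.
have -> : ((a + 1) / a - ((a + 1) / a)^-1) / 2 =
    (2 * a + 1) / (2 * a * (a + 1)) by field; rewrite a0 a1.
have -> : 2 * ((a + 1) / a - 1) / ((a + 1) / a + 1) = 2 / (2 * a + 1).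
  by field; rewrite a0 gt_eqF.
move=> h1 h2; apply/andP; split.
  by rewrite subr_ge0 mulrC -ler_pdivrMr.
apply: (@le_trans _ _ ((2 * a + 1) * ((2 * a + 1) / (2 * a * (a + 1))) - 2)).
  by rewrite lerD2r ler_pM2l.
have -> : (2 * a + 1) * ((2 * a + 1) / (2 * a * (a + 1))) - 2 =
    (a^-1 - (a + 1)^-1) / 2 by field; rewrite a0 a1.
have -> : a^-1 - (a + 1)^-1 = (a * (a + 1))^-1 by field; rewrite a0 a1.
have : 0 < (a * (a + 1))^-1 by rewrite invr_gt0 mulr_gt0//; lra.
lra.
Qed.

Lemma ln_stirling_ratioB_add_bounds n k :
  0 <= ln (stirling_ratio n.+1) - ln (stirling_ratio (n + k).+1) <=
  n.+1%:R^-1 - (n + k).+1%:R^-1.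
Proof.
elim: k => [|k IH]; first by rewrite addn0 !subrr lexx.
rewrite addnS -(subrKA (ln (stirling_ratio (n + k).+1))).
rewrite -(subrKA (n + k).+1%:R^-1 n.+1%:R^-1).
have /andP[h0 h1] := ln_stirling_ratioB_bounds (n + k).
by have /andP[i0 i1] := IH; rewrite addr_ge0// lerD.
Qed.

(** With [m = n + 1], the exponentials of [X m ^ 2] and [X (2m)] are equal, and what remains of
    their quotient is Wallis' ratio. *)
Lemma stirling_ratio_sqr n :
  stirling_ratio n.+1 ^+ 2 =
  2 * wallis_ratio n.+1 ^+ 2 / n.+1%:R * stirling_ratio n.+1.*2 :> R.
Proof.
have := ltn0Sn n; move: n.+1 => m m0; rewrite /stirling_ratio /wallis_ratio.
have -> : expR m.*2.*2%:R = expR m.*2%:R ^+ 2 :> R.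
  by rewrite -expRM_natl -natrM mul2n.
have -> : m.*2%:R = 2 * m%:R :> R by rewrite -natrM mul2n.
set a : R := m%:R.
have -> : (4 : R) = 2 ^+ 2 by ring.
rewrite -exprM [(2 * m)%N]mul2n !exprS -[m.*2.*2]addnn !exprD [(2 * a) ^+ _]exprMn.
set f2 := (m.*2)`!%:R; set c := 2 ^+ m.*2; set b := a ^+ m.*2.
have c0 : c != 0 by rewrite expf_neq0// pnatr_eq0.
have a0 : a != 0 by rewrite pnatr_eq0 -lt0n.
clearbody a.
have b0 : b != 0 by rewrite expf_neq0.
have f0 : f2 != 0 by rewrite pnatr_eq0 -lt0n fact_gt0.
by field; rewrite a0 b0 c0 f0.
Qed.

(** Here [X^2 = q Y] with [q = 2p/a], which Wallis places between [2 pi] and [2 pi (1 + 1/(2a))]. As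
    [X (1 - 1/a) <= Y <= X], division by [X] gives [q (1 - 1/a) <= X <= q]. *)
Lemma stirling_ratio_bounds n :
  2 * pi * (1 - n.+1%:R^-1) <= stirling_ratio n.+1 <=
  2 * pi * (1 + (2 * n.+1%:R)^-1).
Proof.
have X0 := stirling_ratio_gt0 n.
have Y0 : 0 < stirling_ratio n.+1.*2 by rewrite doubleS stirling_ratio_gt0.
have := ln_stirling_ratioB_add_bounds n n.+1.
rewrite (_ : (n + n.+1).+1 = n.+1.*2)%N; last by rewrite -addSn addnn.
have := stirling_ratio_sqr n; have := wallis_ratio_bounds (R := R) n.+1.
set X := stirling_ratio n.+1 in X0 *; set Y := stirling_ratio _ in Y0 *.
set p := wallis_ratio _ ^+ 2; set a : R := n.+1%:R.
have a0 : 0 < a by rewrite ltr0n.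
move=> /andP[p1 p2] XY /andP[l1 l2].
have YX : Y <= X by rewrite -ler_ln ?posrE// -subr_ge0.
have Xe : X * expR (- a^-1) <= Y.
  have a20 : 0 <= n.+1.*2%:R^-1 :> R by rewrite invr_ge0.
  rewrite -[X]lnK ?posrE// -expRD -[leRHS]lnK ?posrE// ler_expR.
  by rewrite lerBlDr -lerBlDl (le_trans l2)// gerBl.
have Xa : X * (1 - a^-1) <= Y.
  by apply: le_trans Xe; rewrite ler_pM2l// expR_ge1Dx.
have pi0 : 0 <= 2 * pi :> R by rewrite mulr_ge0// pi_ge0.
have q1 : 2 * pi <= 2 * p / a by rewrite ler_pdivlMr// -mulrA ler_pM2l.
have q2 : 2 * p / a <= 2 * pi * (1 + (2 * a)^-1).
  rewrite ler_pdivrMr// -!mulrA ler_pM2l//.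
  have -> : (1 + (2 * a)^-1) * a = a + 2^-1 by field; rewrite gt_eqF.
  exact: p2.
have q0 : 0 <= 2 * p / a by exact: le_trans q1.
apply/andP; split; last first.
  by apply: le_trans q2; rewrite -(ler_pM2r X0) -expr2 XY ler_wpM2l.
have [a1|a1] := leP (1 - a^-1) 0.
  by apply: le_trans (ltW X0); rewrite mulr_ge0_le0.
apply: (@le_trans _ _ (2 * p / a * (1 - a^-1))); first by rewrite ler_pM2r.
by rewrite -(ler_pM2r X0) -expr2 XY -[leLHS]mulrA ler_wpM2l// mulrC.
Qed.

End stirling.

(** * Equivalence of the two expressions of the bound *)

Section asymptotics.
Context {R : realType}.

Let bound (n : nat) : R := 1 / (Num.sqrt (n`!%:R) * n%:R `^ (n%:R / 2)).
Let equivalent (n : nat) : R := (2 * pi / n%:R) `^ (1 / 4) *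
  (Num.sqrt (n.+1%:R) / (n`!%:R * expR (n%:R / 2))).

(** The fourth power clears the exponent [1/4] and the square roots, leaving an exact identity with
    Stirling's ratio. *)
Let ratio_expr4 (n : nat) : (0 < n)%N -> (bound n / equivalent n) ^+ 4 =
  stirling_ratio n * n%:R ^+ 2 / (2 * pi * n.+1%:R ^+ 2).
Proof.
move=> n0; have pi0 : pi != 0 :> R by rewrite gt_eqF// pi_gt0.
have b4 : bound n ^+ 4 = 1 / (n`!%:R * n%:R ^+ n) ^+ 2.
  by rewrite (exprM _ 2 2) sqr_sqrt_fact_powR expr_div_n expr1n.
have p4 : ((2 * pi / n%:R) `^ (1 / 4)) ^+ 4 = 2 * pi / n%:R :> R.
  rewrite -powR_mulrn ?powR_ge0// -powRrM divfK ?pnatr_eq0// powRr1//.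
  by rewrite divr_ge0// mulr_ge0// pi_ge0.
have s4 : Num.sqrt n.+1%:R ^+ 4 = n.+1%:R ^+ 2 :> R.
  by rewrite (exprM _ 2 2) sqr_sqrtr.
have e4 : expR (n%:R / 2) ^+ 4 = expR n.*2%:R :> R.
  rewrite -expRM_natl; congr expR; rewrite -mul2n natrM. by field.
have g4 : equivalent n ^+ 4 =
    2 * pi / n%:R * (n.+1%:R ^+ 2 / (n`!%:R ^+ 4 * expR n.*2%:R)).
  by rewrite /equivalent exprMn p4 expr_div_n s4 exprMn e4.
rewrite expr_div_n b4 g4 /stirling_ratio [_ ^+ n.*2.+1]exprS -muln2.
rewrite [_ ^+ (n * 2)]exprM.
have nn0 : n%:R != 0 :> R by rewrite pnatr_eq0 -lt0n.
have n10 : n.+1%:R != 0 :> R by rewrite pnatr_eq0.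
have f0 : n`!%:R != 0 :> R by rewrite pnatr_eq0 -lt0n fact_gt0.
have e0 : expR (n * 2)%:R != 0 :> R by rewrite gt_eqF// expR_gt0.
have h0 : n%:R ^+ n != 0 :> R by rewrite expf_neq0.
move: (pi) pi0 => p pi0.
by field; rewrite nat1r n10 pi0 h0 nn0 e0 f0.
Qed.

(** With [a = n + 1], the bounds on Stirling's ratio place [y^4] between [(a^2 - a)/(a + 1)^2] and
    [(a^2 + a/2)/(a + 1)^2]. *)
Lemma ratio_bounds (n : nat) :
  1 - 3 * n.+2%:R^-1 <= bound n.+1 / equivalent n.+1 <= 1.
Proof.
set y := bound _ / _.
have y0 : 0 <= y.
  by rewrite !(divr_ge0, mulr_ge0) ?powR_ge0 ?sqrtr_ge0 ?expR_ge0.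
have y4 := ratio_expr4 (ltn0Sn n); rewrite -/y in y4.
have pi0 : 0 < 2 * pi :> R by rewrite mulr_gt0// pi_gt0.
have /andP[X1 X2] := stirling_ratio_bounds (R := R) n.
move: y4 X1 X2; rewrite -[n.+2%:R]natr1.
have : 1 <= n.+1%:R :> R by rewrite ler1n.
move: (n.+1%:R) (stirling_ratio _) => a X a1 y4 X1 X2.
have a0 : 0 < a by lra.
have a20 : 0 < (a + 1) ^+ 2 by rewrite exprn_gt0//; lra.
have y1 : y <= 1.
  rewrite -(@expr_le1 _ 4)// y4 ler_pdivrMr ?(mulr_gt0 pi0)// mul1r.
  apply: (@le_trans _ _ (2 * pi * (1 + (2 * a)^-1) * a ^+ 2)).
    by rewrite ler_wpM2r ?sqr_ge0.
  rewrite -mulrA ler_pM2l//.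
  have -> : (1 + (2 * a)^-1) * a ^+ 2 = a ^+ 2 + a / 2 by field; rewrite gt_eqF.
  by rewrite -subr_ge0 (_ : _ - _ = 3 / 2 * a + 1); [lra|field].
rewrite y1 andbT.
(* As [0 <= y <= 1], [y^4 <= y], so a lower bound on [y^4] suffices and no fourth root is taken. *)
apply: (@le_trans _ _ (y ^+ 4)); last by rewrite exprS ler_piMr// exprn_ile1.
rewrite y4 ler_pdivlMr ?(mulr_gt0 pi0)//.
apply: (@le_trans _ _ (2 * pi * (1 - a^-1) * a ^+ 2)); last first.
  by rewrite ler_wpM2r ?sqr_ge0.
rewrite mulrCA -mulrA ler_pM2l//.
have -> : (1 - a^-1) * a ^+ 2 = a ^+ 2 - a by field; rewrite gt_eqF.
have -> : (1 - 3 * (a + 1)^-1) * (a + 1) ^+ 2 = (a + 1) ^+ 2 - 3 * (a + 1).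
  by field; rewrite gt_eqF//; lra.
lra.
Qed.

Lemma asymp_equiv_bound : asymp_equiv bound equivalent.
Proof.
apply/cvgrPdist_le => e e0.
near=> n.
have n0 : (0 < n)%N by near: n; exists 1%N.
have en : 3 * n.+1%:R^-1 <= e.
  rewrite ler_pdivrMr// mulrC -ler_pdivrMr//.
  near: n; exists (Num.truncn (3 / e)) => //= m em.
  by rewrite (le_trans (ltW (truncnS_gt _)))// ler_nat ltnS.
have := ratio_bounds n.-1; rewrite prednK// => /andP[y1 y2].
rewrite ger0_norm ?subr_ge0// (le_trans _ en)//.
by rewrite lerBlDl -lerBlDr.
Unshelve. all: by end_near. Qed.

End asymptotics.

Theorem theorem1p4 (R : realType) :
  (forall (n : nat) (K : set 'rV[R]_n),
     convex_body K -> Behrend_position K ->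
     idq K >= 1 / (Num.sqrt (n`!%:R) * n%:R `^ (n%:R / 2))) /\
  asymp_equiv
    (fun n : nat => 1 / (Num.sqrt (n`!%:R) * n%:R `^ (n%:R / 2)) : R)
    (fun n : nat => (2 * pi / n%:R) `^ (1 / 4) *
       (Num.sqrt (n.+1%:R) / (n`!%:R * expR (n%:R / 2))) : R).
Proof.
split=> [n K bK BK|]; first exact: Behrend_idq_ge.
exact: asymp_equiv_bound.
Qed.
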